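(* Let $\mathcal C$ be a relative category, $\mathbb U\subset\mathbb R^N$ an upset, and fix real constants $0\le S\le1$, $C\ge0$, $\rho>0$. Let $G\colon\mathbb R_{\ge0}\times\mathbb U\to\mathcal C$ be a persistent object equipped with a shrinking transformation $\tau$ (with parameters $S,C,\rho$). Let $\varepsilon_1,\delta\ge0$ be such that $\varepsilon_1\le\min\{\rho-\delta,\frac{1-S}{1+S}\delta\}$ and let $\varepsilon_2\ge0$. Let $F\colon\mathbb R_{\ge0}\times\mathbb U\to\mathcal C$ be another persistent object together with an $(\varepsilon_1,\varepsilon_2)$-interleaving $\varphi\colon F\simeq_{\varepsilon_1,\varepsilon_2}G\colon\psi$ that is $\delta$-compatible with $\tau$. Then there is an interleaving $$\varphi'\colon F^{\delta,\bullet}\simeq_{\varepsilon_2+C\varepsilon_1+C\delta}G^{\delta,\bullet}\colon\psi'$$ in $\mathrm{ho}(\mathcal C^{\mathbb U})$, explicitly given by the compositions $$\varphi'\colon F^{\delta,\bullet}\xrightarrow{\varphi}G^{\delta+\varepsilon_1,\bullet+\varepsilon_2}\xrightarrow{\tau}G^{S(\delta+\varepsilon_1),\bullet+\varepsilon_2+C\varepsilon_1+C\delta}\xrightarrow{s}G^{\delta,\bullet+\varepsilon_2+C\varepsilon_1+C\delta},$$ $$\psi'\colon G^{\delta,\bullet}\xrightarrow{\tau}G^{S\delta,\bullet+C\delta}\xrightarrow{\psi}F^{S\delta+\varepsilon_1,\bullet+C\delta+\varepsilon_2}\xrightarrow{s}F^{\delta,\bullet+\varepsilon_2+C\varepsi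lon_1+C\delta}.$$
   Context: A relative category $\mathcal C=(\mathbf C,W)$ is a category $\mathbf C$ with a wide subcategory $W$ of weak equivalences; $\mathrm{ho}(\mathcal C)=\mathbf C[W^{-1}]$. For a poset $P$ (viewed as a category), $\mathcal C^P$ is the functor category $\mathbf C^P$ with objectwise weak equivalences; its objects are called persistent objects. $\mathbb R^N$ has the componentwise order; an upset is a subset $\mathbb U$ with $x\in\mathbb U,\ x\le y\Rightarrow y\in\mathbb U$; products of posets have the product order. For a scalar $\varepsilon\ge0$ and $u\in\mathbb U$, $u+\varepsilon:=u+(\varepsilon,\dots,\varepsilon)$. Precomposition of a persistent object with a monotone map of indexing posets is written in the superscript, e.g. $G^{S\bullet_1,\bullet_2+C\bullet_1}$ is $(\delta,u)\mapsto G^{S\delta,u+C\delta}$; $F^{\delta,\bullet}$ is the restriction to first coordinate $\delta$. $s$ denotes any morphism induced by the structure maps of a persistent object. For $\varepsilon\ge0$, an $\varepsilon$-interleaving $X^\bullet\simeq_\varepsilon Y^\bullet$ of persistent objects on $\mathbb U$ consists of morphisms $X^\bullet\to Y^{\bullet+\varepsilon}$ and $Y^\bullet\to X^{\bullet+\varepsilon}$ in $\mathrm{ho}(\mathcal C^{\mathbb U})$ whose two (shifted) composites equal $s\colon X^\bullet\to X^{\bullet+2\varepsilon}$ and $s\colon Y^\bullet\to Y^{\bullet+2\varepsilon}$. An $(\varepsilon_1,\varepsilon_2)$-interleaving $\varphi\colon F\simeq_{\varepsilon_1,\varepsilon_2}G\colon\psi$ of persistent objects on $\mathbb R_{\ge0}\times\mathbb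 U$ is defined in the same way in $\mathrm{ho}(\mathcal C^{\mathbb R_{\ge0}\times\mathbb U})$, with shift $(\delta,u)\mapsto(\delta+\varepsilon_1,u+\varepsilon_2)$. A shrinking transformation for $G$ (with parameters $S,C,\rho$) is a morphism $\tau\colon G^{\bullet_1,\bullet_2}|_{[0,\rho]\times\mathbb U}\to G^{S\bullet_1,\bullet_2+C\bullet_1}|_{[0,\rho]\times\mathbb U}$ in $\mathrm{ho}(\mathcal C^{[0,\rho]\times\mathbb U})$ such that $s\circ\tau=s\colon G^{\bullet_1,\bullet_2}|_{[0,\rho]\times\mathbb U}\to G^{\bullet_1,\bullet_2+C\bullet_1}|_{[0,\rho]\times\mathbb U}$. The interleaving $(\varphi,\psi)$ is $\delta$-compatible with $\tau$ if in $\mathrm{ho}(\mathcal C^{\mathbb U})$ the composite $$F^{\delta,\bullet}\xrightarrow{\varphi}G^{\delta+\varepsilon_1,\bullet+\varepsilon_2}\xrightarrow{\tau}G^{S(\delta+\varepsilon_1),\bullet+\varepsilon_2+C(\delta+\varepsilon_1)}\xrightarrow{\psi}F^{S(\delta+\varepsilon_1)+\varepsilon_1,\bullet+2\varepsilon_2+C(\delta+\varepsilon_1)}\xrightarrow{s}F^{\delta,\bullet+2\varepsilon_2+C(\delta+\varepsilon_1)}$$ equals $s\colon F^{\delta,\bullet}\to F^{\delta,\bullet+2\varepsilon_2+C(\delta+\varepsilon_1)}$. *)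

(* Defs.v *)
From HB Require Import structures.
From mathcomp Require Import all_boot all_order all_algebra.
From mathcomp Require Import boolp classical_sets reals interval_inference.
From mathcomp Require Import lra.
From Stdlib Require Import RelationClasses.

Set Implicit Arguments.
Unset Strict Implicit.
Unset Printing Implicit Defensive.

Import Order.TTheory GRing.Theory Num.Theory.

(** Hom-types are setoids: [heq] plays the role of equality of parallel morphisms.
A category in the usual sense is the case where [heq] is Leibniz equality; the
setoid form lets the localization below be given by generators and
relations. *)

Record Category := {
  Ob :> Type;
  Mor : Ob -> Ob -> Type;
  heq : forall x y : Ob, Mor x y -> Mor x y -> Prop;
  idm : forall x : Ob, Mor x x;
  mcomp : forall x y z : Ob, Mor y z -> Mor x y -> Mor x z;
  heq_equiv : forall x y : Ob, Equivalence (@heq x y);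
  comp_heq : forall (x y z : Ob) (g g' : Mor y z) (f f' : Mor x y),
    heq g g' -> heq f f' -> heq (mcomp g f) (mcomp g' f');
  comp_idl : forall (x y : Ob) (f : Mor x y), heq (mcomp (idm y) f) f;
  comp_idr : forall (x y : Ob) (f : Mor x y), heq (mcomp f (idm x)) f;
  comp_assoc : forall (x y z t : Ob) (h : Mor z t) (g : Mor y z) (f : Mor x y),
    heq (mcomp h (mcomp g f)) (mcomp (mcomp h g) f)
}.
Arguments idm {c} x.

Reserved Notation "f =h g" (at level 70, no associativity).
Reserved Notation "g \c f" (at level 45, right associativity).
Reserved Notation "F \O G" (at level 40, left associativity).

Notation "f =h g" := (heq f g).
Notation "g \c f" := (mcomp g f).

#[export] Existing Instance heq_equiv.

(** The functor laws are stated for arbitrary representatives of identities and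
composites. With [fmap_heq] this is the usual definition, but in this form
composition of functors is associative and unital up to conversion, so that
e.g. [X \O f \O g] and [X \O (f \O g)] are interchangeable. *)

#[local] Set Primitive Projections.
Record Functor (C D : Category) := {
  fobj :> C -> D;
  fmap : forall x y : C, Mor x y -> Mor (fobj x) (fobj y);
  fmap_heq : forall (x y : C) (f g : Mor x y), f =h g -> fmap f =h fmap g;
  fmap_id : forall (x : C) (f : Mor x x), f =h idm x -> fmap f =h idm (fobj x);
  fmap_comp : forall (x y z : C) (g : Mor y z) (f : Mor x y) (h : Mor x z),
    h =h g \c f -> fmap h =h fmap g \c fmap f
}.
#[local] Unset Primitive Projections.
Arguments fmap {C D} f0 {x y} _.

Definition functor_id (C : Category) : Functor C C := {|
  fobj := fun x => x;
  fmap := fun _ _ f => f;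
  fmap_heq := fun _ _ _ _ e => e;
  fmap_id := fun _ _ e => e;
  fmap_comp := fun _ _ _ _ _ _ e => e
|}.

Definition functor_comp (A B C : Category) (F : Functor B C) (G : Functor A B) :
    Functor A C := {|
  fobj := fun x => F (G x);
  fmap := fun _ _ f => fmap F (fmap G f);
  fmap_heq := fun _ _ _ _ e => fmap_heq F (fmap_heq G e);
  fmap_id := fun _ _ e => fmap_id F (fmap_id G e);
  fmap_comp := fun _ _ _ _ _ _ e => fmap_comp F (fmap_comp G e)
|}.
Notation "F \O G" := (functor_comp F G).

Record NatTrans (C D : Category) (F G : Functor C D) := {
  ntcomp :> forall x : C, Mor (F x) (G x);
  naturality : forall (x y : C) (f : Mor x y),
    ntcomp y \c fmap F f =h fmap G f \c ntcomp x
}.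

Definition nt_heq (C D : Category) (F G : Functor C D) (a b : NatTrans F G) :=
  forall x : C, a x =h b x.

Section FunctorCategory.
Variables C D : Category.

Lemma nt_id_natural (F : Functor C D) (x y : C) (f : Mor x y) :
  idm (F y) \c fmap F f =h fmap F f \c idm (F x).
Proof.
transitivity (fmap F f); first exact: comp_idl.
by symmetry; apply: comp_idr.
Qed.

Definition nt_id (F : Functor C D) : NatTrans F F :=
  {| ntcomp := fun x => idm (F x); naturality := @nt_id_natural F |}.

Lemma nt_comp_natural (F G H : Functor C D) (b : NatTrans G H)
    (a : NatTrans F G) (x y : C) (f : Mor x y) :
  (b y \c a y) \c fmap F f =h fmap H f \c (b x \c a x).
Proof.
transitivity (b y \c (a y \c fmap F f)); first by symmetry; apply: comp_assoc.
transitivity (b y \c (fmap G f \c a x)).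
  by apply: comp_heq; [reflexivity|apply: naturality].
transitivity ((b y \c fmap G f) \c a x); first exact: comp_assoc.
transitivity ((fmap H f \c b x) \c a x); last by symmetry; apply: comp_assoc.
by apply: comp_heq; [apply: naturality|reflexivity].
Qed.

Definition nt_comp (F G H : Functor C D) (b : NatTrans G H)
    (a : NatTrans F G) : NatTrans F H :=
  {| ntcomp := fun x => b x \c a x; naturality := nt_comp_natural b a |}.

Lemma nt_heq_equiv (F G : Functor C D) : Equivalence (@nt_heq C D F G).
Proof.
split=> [a i|a b ab i|a b c ab bc i]; first reflexivity.
- by symmetry; apply: ab.
- by transitivity (b i); [apply: ab|apply: bc].
Qed.

Definition FunCat : Category := {|
  Ob := Functor C D;
  Mor := @NatTrans C D;
  heq := @nt_heq C D;
  idm := nt_id;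
  mcomp := nt_comp;
  heq_equiv := nt_heq_equiv;
  comp_heq := fun _ _ _ _ _ _ _ e e' i => comp_heq (e i) (e' i);
  comp_idl := fun _ _ f i => comp_idl (f i);
  comp_idr := fun _ _ f i => comp_idr (f i);
  comp_assoc := fun _ _ _ _ h g f i => comp_assoc (h i) (g i) (f i)
|}.

End FunctorCategory.

Record RelCat := {
  ucat :> Category;
  weq : forall x y : ucat, Mor x y -> Prop;
  weq_heq : forall (x y : ucat) (f g : Mor x y), f =h g -> weq f -> weq g;
  weq_id : forall x : ucat, weq (idm x);
  weq_comp : forall (x y z : ucat) (g : Mor y z) (f : Mor x y),
    weq g -> weq f -> weq (g \c f)
}.

Section Localization.
Variable C : RelCat.

(** Formal composites of morphisms of [C] and of formal inverses of weak
equivalences. *)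

Inductive zigzag : C -> C -> Type :=
| Zid x : zigzag x x
| Zfwd x y (f : Mor x y) : zigzag x y
| Zbwd x y (w : Mor x y) (ww : weq w) : zigzag y x
| Zcomp x y z (b : zigzag y z) (a : zigzag x y) : zigzag x z.

(** The least congruence that yields a category, makes [Zfwd] a functor, and
makes [Zbwd w] a two-sided inverse of [Zfwd w]. *)

Inductive zigzag_eq : forall x y : C, zigzag x y -> zigzag x y -> Prop :=
| Zeq_refl x y (a : zigzag x y) : zigzag_eq a a
| Zeq_sym x y (a b : zigzag x y) : zigzag_eq a b -> zigzag_eq b a
| Zeq_trans x y (a b c : zigzag x y) :
    zigzag_eq a b -> zigzag_eq b c -> zigzag_eq a c
| Zeq_comp x y z (b b' : zigzag y z) (a a' : zigzag x y) :
    zigzag_eq b b' -> zigzag_eq a a' -> zigzag_eq (Zcomp b a) (Zcomp b' a')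
| Zeq_idl x y (a : zigzag x y) : zigzag_eq (Zcomp (Zid y) a) a
| Zeq_idr x y (a : zigzag x y) : zigzag_eq (Zcomp a (Zid x)) a
| Zeq_assoc x y z t (c : zigzag z t) (b : zigzag y z) (a : zigzag x y) :
    zigzag_eq (Zcomp c (Zcomp b a)) (Zcomp (Zcomp c b) a)
| Zeq_fwd x y (f g : Mor x y) : f =h g -> zigzag_eq (Zfwd f) (Zfwd g)
| Zeq_fwd_id x : zigzag_eq (Zfwd (idm x)) (Zid x)
| Zeq_fwd_comp x y z (g : Mor y z) (f : Mor x y) :
    zigzag_eq (Zfwd (g \c f)) (Zcomp (Zfwd g) (Zfwd f))
| Zeq_bwd_fwd x y (w : Mor x y) (ww : weq w) :
    zigzag_eq (Zcomp (Zbwd ww) (Zfwd w)) (Zid x)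
| Zeq_fwd_bwd x y (w : Mor x y) (ww : weq w) :
    zigzag_eq (Zcomp (Zfwd w) (Zbwd ww)) (Zid y).

Lemma zigzag_eq_equiv (x y : C) : Equivalence (@zigzag_eq x y).
Proof.
by split=> [a|a b|a b c]; [apply: Zeq_refl|apply: Zeq_sym|apply: Zeq_trans].
Qed.

Definition ho : Category := {|
  Ob := C;
  Mor := zigzag;
  heq := zigzag_eq;
  idm := Zid;
  mcomp := Zcomp;
  heq_equiv := zigzag_eq_equiv;
  comp_heq := Zeq_comp;
  comp_idl := Zeq_idl;
  comp_idr := Zeq_idr;
  comp_assoc := Zeq_assoc
|}.

Definition loc (x y : C) (f : Mor x y) : @Mor ho x y := Zfwd f.

End Localization.

Section HoFunctor.
Variables (C D : RelCat) (F : Functor C D).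
Hypothesis F_weq : forall (x y : C) (f : Mor x y), weq f -> weq (fmap F f).

Fixpoint zigzag_map (x y : C) (a : zigzag x y) : zigzag (F x) (F y) :=
  match a with
  | Zid x => Zid (F x)
  | Zfwd _ _ f => Zfwd (fmap F f)
  | Zbwd _ _ _ ww => Zbwd (F_weq ww)
  | Zcomp _ _ _ b a => Zcomp (zigzag_map b) (zigzag_map a)
  end.

Lemma zigzag_map_heq (x y : C) (a b : zigzag x y) :
  zigzag_eq a b -> zigzag_eq (zigzag_map a) (zigzag_map b).
Proof.
elim=> {x y a b} /=; try by intros; econstructor; eauto.
- by move=> x y f g fg; apply/Zeq_fwd/fmap_heq.
- move=> x; apply: Zeq_trans (Zeq_fwd_id _); apply/Zeq_fwd/fmap_id.
  reflexivity.
- move=> x y z g f; apply: Zeq_trans (Zeq_fwd_comp _ _); apply/Zeq_fwd/fmap_comp.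
  reflexivity.
Qed.

Lemma zigzag_map_id (x : C) (a : zigzag x x) :
  zigzag_eq a (Zid x) -> zigzag_eq (zigzag_map a) (Zid (F x)).
Proof. exact: zigzag_map_heq. Qed.

Lemma zigzag_map_comp (x y z : C) (b : zigzag y z) (a : zigzag x y)
    (c : zigzag x z) :
  zigzag_eq c (Zcomp b a) ->
  zigzag_eq (zigzag_map c) (Zcomp (zigzag_map b) (zigzag_map a)).
Proof. exact: zigzag_map_heq. Qed.

Definition ho_functor : Functor (ho C) (ho D) := {|
  fobj := fun x : ho C => (F x : ho D);
  fmap := zigzag_map;
  fmap_heq := zigzag_map_heq;
  fmap_id := zigzag_map_id;
  fmap_comp := zigzag_map_comp
|}.

End HoFunctor.

Definition poset_cat d (P : porderType d) : Category := {|
  Ob := P;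
  Mor := fun x y : P => (x <= y)%O;
  heq := fun _ _ _ _ => True;
  idm := fun x => lexx x;
  mcomp := fun _ _ _ yz xy => le_trans xy yz;
  heq_equiv := fun _ _ => Build_Equivalence _ (fun _ => I) (fun _ _ _ => I)
    (fun _ _ _ _ _ => I);
  comp_heq := fun _ _ _ _ _ _ _ _ _ => I;
  comp_idl := fun _ _ _ => I;
  comp_idr := fun _ _ _ => I;
  comp_assoc := fun _ _ _ _ _ _ _ => I
|}.

Definition monotone d d' (P : porderType d) (Q : porderType d') :=
  Functor (poset_cat P) (poset_cat Q).

Definition mono d d' (P : porderType d) (Q : porderType d') (f : P -> Q)
    (f_homo : {homo f : x y / (x <= y)%O}) : monotone P Q := {|
  fobj := f : poset_cat P -> poset_cat Q;
  fmap := f_homo;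
  fmap_heq := fun _ _ _ _ _ => I;
  fmap_id := fun _ _ _ => I;
  fmap_comp := fun _ _ _ _ _ _ _ => I
|}.

Section Persistent.
Variable C : RelCat.

Definition Persistent d (P : porderType d) := Functor (poset_cat P) C.

Definition PersCat d (P : porderType d) : RelCat := {|
  ucat := FunCat (poset_cat P) C;
  weq := fun X Y (a : NatTrans X Y) => forall p, weq (a p);
  weq_heq := fun _ _ _ _ ab wa p => weq_heq (ab p) (wa p);
  weq_id := fun _ _ => weq_id _;
  weq_comp := fun _ _ _ _ _ wb wa p => weq_comp (wb p) (wa p)
|}.

Definition hoP d (P : porderType d) : Category := ho (PersCat P).

Section Restriction.
Variables (d d' : Order.disp_t) (P : porderType d) (Q : porderType d').

Definition whisker (f : monotone Q P) (X Y : Persistent P) (a : NatTrans X Y) :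
    NatTrans (X \O f) (Y \O f) :=
  @Build_NatTrans _ _ (X \O f) (Y \O f) (fun q => a (f q))
    (fun _ _ h => naturality a (fmap f h)).

Definition precomp (f : monotone Q P) : Functor (PersCat P) (PersCat Q) := {|
  fobj := fun X : PersCat P => X \O f : PersCat Q;
  fmap := @whisker f;
  fmap_heq := fun _ _ _ _ e q => e (f q);
  fmap_id := fun _ _ e q => e (f q);
  fmap_comp := fun _ _ _ _ _ _ e q => e (f q)
|}.

Definition ho_precomp (f : monotone Q P) : Functor (hoP P) (hoP Q) :=
  @ho_functor (PersCat P) (PersCat Q) (precomp f)
    (fun _ _ _ wa q => wa (f q)).

Definition restr (f : monotone Q P) (X Y : Persistent P)
    (a : @Mor (hoP P) X Y) : @Mor (hoP Q) (X \O f) (Y \O f) :=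
  fmap (ho_precomp f) a.

Lemma str_natural (X : Persistent P) (f g : monotone Q P)
    (fg : forall q, (f q <= g q)%O) (q r : Q) (h : (q <= r)%O) :
  fmap X (fg r) \c fmap (X \O f) h =h fmap (X \O g) h \c fmap X (fg q).
Proof.
transitivity (fmap X (le_trans (fg q) (fmap g h) : @Mor (poset_cat P) _ _)).
  by symmetry; apply: (@fmap_comp _ _ X _ _ _ (fg r) (fmap f h)).
exact: (@fmap_comp _ _ X _ _ _ (fmap g h) (fg q)).
Qed.

Definition str_nt (X : Persistent P) (f g : monotone Q P)
    (fg : forall q, (f q <= g q)%O) : NatTrans (X \O f) (X \O g) :=
  @Build_NatTrans _ _ (X \O f) (X \O g) (fun q => fmap X (fg q))
    (str_natural X fg).

(** The morphism written [s] in the homotopy category. When [f] and [g] agree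
pointwise, it is the identification of [X \O f] with [X \O g]. *)

Definition str (X : Persistent P) (f g : monotone Q P)
    (fg : forall q, (f q <= g q)%O) : @Mor (hoP Q) (X \O f) (X \O g) :=
  @loc (PersCat Q) _ _ (str_nt X fg).

End Restriction.

(** Interleavings along a shift [T] of [P]. For the translation by [e], the
translation by [2e] is represented as [T \O T]. *)

Section Interleaving.
Variables (d : Order.disp_t) (P : porderType d) (T : monotone P P).
Hypothesis T_ge : forall p, (p <= T p)%O.

Lemma double_shift_ge (p : P) : (functor_id (poset_cat P) p <= (T \O T) p)%O.
Proof. exact: le_trans (T_ge p) (T_ge (T p)). Qed.

Record Interleaving (X Y : Persistent P) := {
  il_fwd : @Mor (hoP P) X (Y \O T);
  il_bwd : @Mor (hoP P) Y (X \O T);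
  il_bwd_fwd : restr T il_bwd \c il_fwd =h
    (str X double_shift_ge : @Mor (hoP P) X (X \O T \O T));
  il_fwd_bwd : restr T il_fwd \c il_bwd =h
    (str Y double_shift_ge : @Mor (hoP P) Y (Y \O T \O T))
}.

End Interleaving.
End Persistent.

Section SubPoset.
Variables (d : Order.disp_t) (T : porderType d) (A : set T).
HB.instance Definition _ := Choice.on (set_type A).
HB.instance Definition _ : Order.POrder d (set_type A) :=
  [POrder of (set_type A) by <:].
End SubPoset.

Local Open Scope ring_scope.
Local Open Scope classical_set_scope.

Section Shifts.
Variables (R : realType) (N : nat).

Definition is_upset (U : set ('I_N -> R)) : Prop :=
  forall x y : 'I_N -> R, U x -> (x <= y)%O -> U y.

Variables (U : set ('I_N -> R)) (hU : is_upset U).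

Definition strip := ({nonneg R} *p set_type U)%type.

Definition seg (rho : {posnum R}) : set {nonneg R} :=
  [set x | x%:num <= rho%:num].

Definition seg_strip (rho : {posnum R}) :=
  (set_type (seg rho) *p set_type U)%type.

Lemma translate_proof (e : {nonneg R}) (u : set_type U) :
  (fun i => val u i + e%:num) \in U.
Proof.
apply/mem_set/(hU (set_mem (valP u)))/lefP => i.
by rewrite -[leLHS]/(val u i) lerDl.
Qed.

Definition translate (e : {nonneg R}) (u : set_type U) : set_type U :=
  exist (fun x => x \in U) _ (translate_proof e u).

Lemma translate_le (e e' : {nonneg R}) (u v : set_type U) :
  e%:num <= e'%:num -> (u <= v)%O -> (translate e u <= translate e' v)%O.
Proof. by move=> ee /lefP uv; apply/lefP => i; apply: lerD => //; apply: uv. Qed.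

Lemma translate_ge (e : {nonneg R}) (u : set_type U) : (u <= translate e u)%O.
Proof. by apply/lefP => i; rewrite -[leLHS]/(val u i) lerDl. Qed.

Lemma translate_homo (e : {nonneg R}) :
  {homo translate e : u v / (u <= v)%O}.
Proof. by move=> u v; apply: translate_le. Qed.

Definition shiftU (e : {nonneg R}) : monotone (set_type U) (set_type U) :=
  mono (translate_homo e).

Definition strip_translate (e1 e2 : {nonneg R}) (p : strip) : strip :=
  ((p.1%:num + e1%:num)%:nng, translate e2 p.2).

Lemma strip_translate_homo (e1 e2 : {nonneg R}) :
  {homo strip_translate e1 e2 : p q / (p <= q)%O}.
Proof.
move=> p q /andP[p1 p2]; apply/andP; split; last exact: translate_le.
by rewrite -num_le /= lerD2r num_le.
Qed.

Lemma strip_translate_ge (e1 e2 : {nonneg R}) (p : strip) :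
  (p <= strip_translate e1 e2 p)%O.
Proof.
apply/andP; split; last exact: translate_ge.
by rewrite -num_le /= lerDl.
Qed.

Definition shift2 (e1 e2 : {nonneg R}) : monotone strip strip :=
  mono (strip_translate_homo e1 e2).

(** Restriction along [slice d] gives [F^{d,.}]. *)

Lemma slice_homo (d : {nonneg R}) :
  {homo (fun u : set_type U => (d, u) : strip) : u v / (u <= v)%O}.
Proof. by move=> u v uv; apply/andP. Qed.

Definition slice (d : {nonneg R}) : monotone (set_type U) strip :=
  mono (slice_homo d).

Section Segment.
Variable rho : {posnum R}.

Lemma seg_slice_homo (d : set_type (seg rho)) :
  {homo (fun u : set_type U => (d, u) : seg_strip rho) : u v / (u <= v)%O}.
Proof. by move=> u v uv; apply/andP. Qed.

Definition seg_slice (d : set_type (seg rho)) :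
    monotone (set_type U) (seg_strip rho) :=
  mono (seg_slice_homo d).

Definition seg_in (d : {nonneg R}) (hd : d%:num <= rho%:num) :
    set_type (seg rho) :=
  exist (fun x => x \in seg rho) d (mem_set hd).

Lemma seg_incl_homo :
  {homo (fun p : seg_strip rho => (val p.1, p.2) : strip) : p q / (p <= q)%O}.
Proof. by []. Qed.

Definition seg_incl : monotone (seg_strip rho) strip := mono seg_incl_homo.

(** [(d, u) |-> (S d, u + c d)] *)
Definition shrink_fun (S : {i01 R}) (c : {nonneg R}) (p : seg_strip rho) :
    strip :=
  ((S%:num * (val p.1)%:num)%:nng,
   translate (c%:num * (val p.1)%:num)%:nng p.2).

Lemma shrink_homo (S : {i01 R}) (c : {nonneg R}) :
  {homo shrink_fun S c : p q / (p <= q)%O}.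
Proof.
move=> p q /andP[p1 p2]; apply/andP; split.
- by rewrite -num_le /= ler_wpM2l // num_le.
- by apply: translate_le => //=; rewrite ler_wpM2l // num_le.
Qed.

Definition shrink (S : {i01 R}) (c : {nonneg R}) :
    monotone (seg_strip rho) strip :=
  mono (shrink_homo S c).

(** [(d, u) |-> (d, u + c d)] *)
Definition seg_rise_fun (c : {nonneg R}) (p : seg_strip rho) : strip :=
  (val p.1, translate (c%:num * (val p.1)%:num)%:nng p.2).

Lemma seg_rise_homo (c : {nonneg R}) :
  {homo seg_rise_fun c : p q / (p <= q)%O}.
Proof.
move=> p q /andP[p1 p2]; apply/andP; split => //.
by apply: translate_le => //=; rewrite ler_wpM2l // num_le.
Qed.

Definition seg_rise (c : {nonneg R}) : monotone (seg_strip rho) strip :=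
  mono (seg_rise_homo c).

Lemma shrink_le_rise (S : {i01 R}) (c : {nonneg R}) (p : seg_strip rho) :
  (shrink S c p <= seg_rise c p)%O.
Proof.
apply/andP; split => //=.
by rewrite -num_le /= ler_piMl.
Qed.

Lemma incl_le_rise (c : {nonneg R}) (p : seg_strip rho) :
  (seg_incl p <= seg_rise c p)%O.
Proof. by apply/andP; split => //=; apply: translate_ge. Qed.

End Segment.

Variable C : RelCat.

Definition InterleavingU (e : {nonneg R}) (X Y : Persistent C (set_type U)) :=
  Interleaving (translate_ge e : forall u, (u <= shiftU e u)%O) X Y.

Definition Interleaving2 (e1 e2 : {nonneg R}) (X Y : Persistent C strip) :=
  Interleaving (strip_translate_ge e1 e2 : forall p, (p <= shift2 e1 e2 p)%O)
    X Y.

Record Shrinking (S : {i01 R}) (c : {nonneg R}) (rho : {posnum R})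
    (G : Persistent C strip) := {
  sh_map :> @Mor (hoP C (seg_strip rho)) (G \O seg_incl rho)
              (G \O shrink rho S c);
  sh_str : str G (shrink_le_rise S c) \c sh_map =h
    str G (@incl_le_rise rho c)
}.

Section Composites.
Variables (S : {i01 R}) (c : {nonneg R}) (rho : {posnum R}).
Variables (d e1 e2 : {nonneg R}).
Hypothesis he : e1%:num <= Num.min (rho%:num - d%:num)
  ((1 - S%:num) / (1 + S%:num) * d%:num).

Lemma small_de1 : (d%:num + e1%:num)%:nng%:num <= rho%:num.
Proof. by move: he; rewrite le_min => /andP[h _] /=; lra. Qed.

Lemma small_d : d%:num <= rho%:num.
Proof. by apply: le_trans small_de1; rewrite /= lerDl. Qed.

Lemma small_shrink : S%:num * (d%:num + e1%:num) + e1%:num <= d%:num.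
Proof.
move: he; rewrite le_min => /andP[_].
have S1 : 0 < 1 + S%:num by rewrite ltr_pwDl.
rewrite mulrAC ler_pdivlMr // => h; lra.
Qed.

Lemma small_shrink_d : S%:num * (d%:num + e1%:num) <= d%:num.
Proof. by apply: le_trans small_shrink; rewrite lerDl. Qed.

Lemma small_shrink_e1 : S%:num * d%:num + e1%:num <= d%:num.
Proof.
apply: le_trans small_shrink; rewrite lerD2r ler_wpM2l //.
by rewrite lerDl.
Qed.

Let at_d : monotone (set_type U) (seg_strip rho) := seg_slice (seg_in small_d).

(** [u |-> (d + e1, u + e2)]; it agrees pointwise with [shift2 e1 e2 \O slice d]
but takes values in [seg_strip rho]. *)
Let at_de1 : monotone (set_type U) (seg_strip rho) :=
  seg_slice (seg_in small_de1) \O shiftU e2.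

Lemma slice_shift2_le (u : set_type U) :
  ((shift2 e1 e2 \O slice d) u <= (seg_incl rho \O at_de1) u)%O.
Proof. exact: lexx. Qed.

Lemma slice_le (u : set_type U) : (slice d u <= (seg_incl rho \O at_d) u)%O.
Proof. exact: lexx. Qed.

Let compat_shift : {nonneg R} :=
  (2 * e2%:num + c%:num * (d%:num + e1%:num))%:nng.

Lemma strip_leP (p q : strip) :
  p.1%:num <= q.1%:num -> (forall i, val p.2 i <= val q.2 i) -> (p <= q)%O.
Proof. by move=> p1 p2; apply/andP; split; [rewrite -num_le|apply/lefP]. Qed.

Lemma compat_le (u : set_type U) :
  ((shift2 e1 e2 \O shrink rho S c \O at_de1) u <=
   (slice d \O shiftU compat_shift) u)%O.
Proof. by apply: strip_leP => [|i] /=; [exact: small_shrink|lra]. Qed.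

Lemma slice_compat_ge (u : set_type U) :
  (slice d u <= (slice d \O shiftU compat_shift) u)%O.
Proof. by apply/andP; split => //; apply: translate_ge. Qed.

Lemma fwd_le (u : set_type U) :
  ((shrink rho S c \O at_de1) u <=
   (slice d \O
      shiftU (e2%:num + c%:num * e1%:num + c%:num * d%:num)%:nng) u)%O.
Proof. by apply: strip_leP => [|i] /=; [exact: small_shrink_d|lra]. Qed.

Lemma bwd_le (u : set_type U) :
  ((shift2 e1 e2 \O shrink rho S c \O at_d) u <=
   (slice d \O
      shiftU (e2%:num + c%:num * e1%:num + c%:num * d%:num)%:nng) u)%O.
Proof.
apply: strip_leP => [|i] /=; first exact: small_shrink_e1.
have : 0 <= c%:num * e1%:num by [].
lra.
Qed.

Variables (F G : Persistent C strip) (tau : Shrinking S c rho G).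

Section Fwd.
Variable phi : @Mor (hoP C strip) F (G \O shift2 e1 e2).

(** [F^{d,.}] to [G^{S(d+e1), . + e2 + c(d+e1)}] *)
Definition phi_tau : @Mor (hoP C (set_type U)) (F \O slice d)
    (G \O (shrink rho S c \O at_de1)) :=
  restr at_de1 tau \c str G slice_shift2_le \c restr (slice d) phi.

Definition fwd_composite : @Mor (hoP C (set_type U)) (F \O slice d)
    (G \O slice d \O
      shiftU (e2%:num + c%:num * e1%:num + c%:num * d%:num)%:nng) :=
  str G fwd_le \c phi_tau.

End Fwd.

Definition bwd_composite (psi : @Mor (hoP C strip) G (F \O shift2 e1 e2)) :
    @Mor (hoP C (set_type U)) (G \O slice d)
      (F \O slice d \O
        shiftU (e2%:num + c%:num * e1%:num + c%:num * d%:num)%:nng) :=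
  str F bwd_le \c restr (shrink rho S c \O at_d) psi \c
    restr at_d tau \c str G slice_le.

Definition compatible (I : Interleaving2 e1 e2 F G) : Prop :=
  (str F compat_le \c restr (shrink rho S c \O at_de1) (il_bwd I) \c
    phi_tau (il_fwd I) : @Mor (hoP C (set_type U)) _ _) =h
  str F slice_compat_ge.

End Composites.
End Shifts.

(* Main.v *)
(** A morphism of the homotopy category of persistent objects still commutes
with structure maps, by induction on zigzags. Hence [tau] can be moved along a
structure map to a smaller first coordinate, where [s \c tau = s] absorbs it.
In [psi' \c phi'] the [tau] of [psi'] disappears in this way, and what remains is
the composite of the compatibility hypothesis. In [phi' \c psi'] the middle part
[phi \c s \c psi] is a structure map of [G] because [phi], [psi] interleave, and
then both [tau]'s are absorbed, first that of [phi'] and then that of [psi']. *)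

Require Import Defs.
From mathcomp Require Import all_boot all_order all_algebra.
From mathcomp Require Import boolp classical_sets reals interval_inference.
From mathcomp Require Import lra.
From Stdlib Require Import Morphisms.
Import Order.TTheory GRing.Theory Num.Theory.
Local Open Scope ring_scope.

Set Implicit Arguments.
Unset Strict Implicit.

(** * Setoid rewriting and commuting squares *)

#[local] Instance mcomp_proper (K : Category) (x y z : K) :
  Proper (@heq K y z ==> @heq K x y ==> @heq K x z) (@mcomp K x y z).
Proof. by move=> g g' gg' f f' ff'; apply: comp_heq. Qed.

Lemma square_paste (K : Category) (x y z x' y' z' : K)
    (f : Mor x y) (g : Mor y z) (f' : Mor x' y') (g' : Mor y' z')
    (s : Mor x x') (t : Mor y y') (u : Mor z z') :
  g' \c t =h u \c g -> f' \c s =h t \c f ->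
  (g' \c f') \c s =h u \c g \c f.
Proof. by move=> gt fs; rewrite -comp_assoc fs !comp_assoc gt; reflexivity. Qed.

(** This is the case of a formal inverse [Zbwd] in the induction on zigzags. *)
Lemma square_inverse (K : Category) (x y x' y' : K)
    (w : Mor x y) (v : Mor y x) (w' : Mor x' y') (v' : Mor y' x')
    (s : Mor x x') (t : Mor y y') :
  w \c v =h idm y -> v' \c w' =h idm x' ->
  w' \c s =h t \c w -> v' \c t =h s \c v.
Proof.
move=> wv vw ws; rewrite -[v' \c t]comp_idr -wv -comp_assoc.
by rewrite [t \c _]comp_assoc -ws -comp_assoc comp_assoc vw comp_idl; reflexivity.
Qed.

(** * Naturality of structure maps in the homotopy categories *)

Section Calculus.
Variable C : RelCat.

Lemma restr_heq d d' (P : porderType d) (Q : porderType d') (f : monotone Q P)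
    (X Y : Persistent C P) (a b : @Mor (hoP C P) X Y) :
  a =h b -> restr f a =h restr f b.
Proof. exact: (fmap_heq (ho_precomp C f)). Qed.

(** Both sides are the same zigzag, since whiskering in two stages is convertible to whiskering
    along the composite. *)
Lemma restr_restr d d' d'' (P : porderType d) (Q : porderType d')
    (V : porderType d'') (f : monotone Q P) (g : monotone V Q)
    (X Y : Persistent C P) (a : @Mor (hoP C P) X Y) :
  restr g (restr f a) =h (restr (f \O g) a : @Mor (hoP C V) _ _).
Proof.
suff -> : restr (f \O g) a = restr g (restr f a) by reflexivity.
rewrite /restr /=.
by elim: a => //= x y z b -> a ->.
Qed.

(** The inequality on the right is a separate argument: parallel morphisms of [poset_cat] are all
    [heq], so every proof of it induces the same structure map. *)
Lemma restr_str d d' d'' (P : porderType d) (Q : porderType d')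
    (V : porderType d'') (X : Persistent C P) (f g : monotone Q P)
    (fg : forall q, (f q <= g q)%O) (k : monotone V Q)
    (fgk : forall v, ((f \O k) v <= (g \O k) v)%O) :
  restr k (str X fg) =h (str X fgk : @Mor (hoP C V) _ _).
Proof. by apply: Zeq_fwd => v /=; apply: fmap_heq. Qed.

Lemma str_comp d d' (P : porderType d) (Q : porderType d')
    (X : Persistent C P) (f g h : monotone Q P)
    (fg : forall q, (f q <= g q)%O) (gh : forall q, (g q <= h q)%O)
    (fh : forall q, (f q <= h q)%O) :
  str X gh \c str X fg =h (str X fh : @Mor (hoP C Q) _ _).
Proof.
apply: Zeq_trans (Zeq_sym (Zeq_fwd_comp _ _)) _; apply: Zeq_fwd => q /=.
by symmetry; apply: fmap_comp.
Qed.

(** Genuine transformations satisfy this by naturality; commuting squares can be pasted and inverted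
    along weak equivalences, which extends it to zigzags. *)
Lemma restr_natural d d' (P : porderType d) (Q : porderType d')
    (f g : monotone Q P) (fg : forall q, (f q <= g q)%O)
    (X Y : Persistent C P) (a : @Mor (hoP C P) X Y) :
  restr g a \c str X fg =h (str Y fg \c restr f a : @Mor (hoP C Q) _ _).
Proof.
elim: a => [Z|Z Z' b|Z Z' w ww|Z Z' Z'' b IHb a IHa] /=.
- exact: Zeq_trans (Zeq_idl _) (Zeq_sym (Zeq_idr _)).
- apply: Zeq_trans (Zeq_sym (Zeq_fwd_comp _ _)) _.
  apply: Zeq_trans (Zeq_fwd_comp _ _); apply: Zeq_fwd => q /=.
  exact: naturality.
- apply: (@square_inverse (hoP C Q) _ _ _ _ (restr f (Zfwd w)) _ (restr g (Zfwd w))).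
  + exact: Zeq_fwd_bwd.
  + exact: Zeq_bwd_fwd.
  + apply: Zeq_trans (Zeq_sym (Zeq_fwd_comp _ _)) _.
    apply: Zeq_trans (Zeq_fwd_comp _ _); apply: Zeq_fwd => q /=.
    exact: naturality.
- exact: (@square_paste (hoP C Q)) IHb IHa.
Qed.

Lemma str_whisker d d' d'' (P : porderType d) (Q : porderType d')
    (V : porderType d'') (X : Persistent C P) (f : monotone Q P)
    (p q : monotone V Q) (pq : forall v, (p v <= q v)%O)
    (fpq : forall v, ((f \O p) v <= (f \O q) v)%O) :
  @heq (hoP C V) (X \O f \O p) (X \O f \O q) (str (X \O f) pq) (str X fpq).
Proof.
by apply: Zeq_fwd => v; apply: (@fmap_heq _ _ X _ _ (fmap f (pq v)) (fpq v)).
Qed.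

(** Form suited to [tau], which lives only over [Q] and joins two different restrictions; the
    structure maps are those of [X] and [Y] themselves. *)
Lemma restr_natural_str d d' d'' (P : porderType d) (Q : porderType d')
    (V : porderType d'') (X Y : Persistent C P) (i t : monotone Q P)
    (a : @Mor (hoP C Q) (X \O i) (Y \O t))
    (p q : monotone V Q) (pq : forall v, (p v <= q v)%O)
    (ipq : forall v, ((i \O p) v <= (i \O q) v)%O)
    (tpq : forall v, ((t \O p) v <= (t \O q) v)%O) :
  restr q a \c str X ipq =h
    (str Y tpq \c restr p a : @Mor (hoP C V) (X \O (i \O p)) (Y \O (t \O q))).
Proof.
apply: Zeq_trans (Zeq_comp (Zeq_refl _) (Zeq_sym (str_whisker X pq ipq))) _.
exact: Zeq_trans (restr_natural pq a) (Zeq_comp (str_whisker Y pq tpq) (Zeq_refl _)).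
Qed.

(** Form suited to [phi] and [psi]: the case where [i] is the identity, as [X \O functor_id _] is
    convertible to [X]. *)
Lemma restr_natural_map d d' (P : porderType d) (V : porderType d')
    (X Y : Persistent C P) (T : monotone P P) (a : @Mor (hoP C P) X (Y \O T))
    (p q : monotone V P) (pq : forall v, (p v <= q v)%O)
    (Tpq : forall v, ((T \O p) v <= (T \O q) v)%O) :
  restr q a \c str X pq =h
    (str Y Tpq \c restr p a : @Mor (hoP C V) (X \O p) (Y \O (T \O q))).
Proof.
exact: (@restr_natural_str _ _ _ _ _ _ X Y (functor_id (poset_cat P)) T a
  _ _ pq pq Tpq).
Qed.

(** * Absorbing the shrinking transformation and the interleaving *)

Section Absorption.
Variables (d d' d'' : Order.disp_t).
Variables (P : porderType d) (Q : porderType d') (V : porderType d'').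
Variables (G : Persistent C P) (i t r : monotone Q P).
Hypotheses (tr : forall q, (t q <= r q)%O) (ir : forall q, (i q <= r q)%O).
Variable tau : @Mor (hoP C Q) (G \O i) (G \O t).
Hypothesis tau_str : str G tr \c tau =h str G ir.

(** [tau] at [p] may be replaced by [tau] at a smaller [q] through which the
incoming structure map factors; there it is absorbed by the outgoing one. *)
Lemma shrink_absorb (p q : monotone V Q) (qp : forall v, (q v <= p v)%O)
    (f k : monotone V P) (fi : forall v, (f v <= (i \O p) v)%O)
    (fq : forall v, (f v <= (i \O q) v)%O)
    (rk : forall v, ((r \O q) v <= k v)%O)
    (tk : forall v, ((t \O p) v <= k v)%O) (fk : forall v, (f v <= k v)%O) :
  str G tk \c restr p tau \c str G fi =h (str G fk : @Mor (hoP C V) _ _).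
Proof.
have iqp v : ((i \O q) v <= (i \O p) v)%O by apply: (fmap i (qp v)).
have tqp v : ((t \O q) v <= (t \O p) v)%O by apply: (fmap t (qp v)).
have trq v : ((t \O q) v <= (r \O q) v)%O by apply: tr.
have irq v : ((i \O q) v <= (r \O q) v)%O by apply: ir.
have tqk v := le_trans (trq v) (rk v).
have iqk v := le_trans (irq v) (rk v).
rewrite -(str_comp G fq iqp fi).
rewrite [restr p tau \c _]comp_assoc (restr_natural_str tau qp iqp tqp).
rewrite -[(str G tqp \c _) \c _]comp_assoc comp_assoc (str_comp G tqp tk tqk).
(* Routing the outgoing structure map through [r] at [q] exposes the restriction of [tau_str] along
   [q]. *)
rewrite -(str_comp G trq rk tqk) -comp_assoc [str G trq \c _]comp_assoc.
rewrite -(restr_str G tr trq).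
rewrite -[restr q (str G tr) \c restr q tau]/(restr q (str G tr \c tau)).
rewrite (restr_heq q tau_str) (restr_str G ir irq).
by rewrite comp_assoc (str_comp G irq rk iqk); apply: (str_comp G).
Qed.

Variables (F : Persistent C P) (T : monotone P P).

(** Naturality moves [psi] to stage [k], ahead of which [shrink_absorb] removes [tau]; naturality
    then moves [psi] back to stage [f]. *)
Lemma shrink_absorb_map (psi : @Mor (hoP C P) G (F \O T))
    (p q : monotone V Q) (qp : forall v, (q v <= p v)%O)
    (f k h : monotone V P) (fi : forall v, (f v <= (i \O p) v)%O)
    (fq : forall v, (f v <= (i \O q) v)%O)
    (rk : forall v, ((r \O q) v <= k v)%O)
    (tk : forall v, ((t \O p) v <= k v)%O)
    (Tkh : forall v, ((T \O k) v <= h v)%O)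
    (Tth : forall v, ((T \O t \O p) v <= h v)%O)
    (Tfh : forall v, ((T \O f) v <= h v)%O) :
  str F Tth \c restr (t \O p) psi \c restr p tau \c str G fi =h
    (str F Tfh \c restr f psi : @Mor (hoP C V) (G \O f) (F \O h)).
Proof.
have fk v : (f v <= k v)%O.
  exact: le_trans (fq v) (le_trans (ir (q v)) (rk v)).
have Ttk v : ((T \O (t \O p)) v <= (T \O k) v)%O by apply: (fmap T (tk v)).
have Tfk v : ((T \O f) v <= (T \O k) v)%O by apply: (fmap T (fk v)).
rewrite -(str_comp F Ttk Tkh Tth) -(str_comp F Tfk Tkh Tfh).
rewrite -!comp_assoc [str F Ttk \c _]comp_assoc -(restr_natural_map psi tk)
  -(restr_natural_map psi fk).
by rewrite -comp_assoc (shrink_absorb qp fi fq rk tk fk); reflexivity.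
Qed.

End Absorption.

(** Naturality slides [il_fwd] past the structure map until it meets [il_bwd], and the interleaving
    identity applies. *)
Lemma interleaving_absorb d d' (P : porderType d) (V : porderType d')
    (T : monotone P P) (T_ge : forall p, (p <= T p)%O) (F G : Persistent C P)
    (I : Interleaving T_ge F G) (m k : monotone V P)
    (Tmk : forall v, ((T \O m) v <= k v)%O)
    (mTk : forall v, (m v <= (T \O k) v)%O) :
  restr k (il_fwd I) \c str F Tmk \c restr m (il_bwd I) =h
    (str G mTk : @Mor (hoP C V) (G \O m) (G \O T \O k)).
Proof.
have TTmk v : ((T \O (T \O m)) v <= (T \O k) v)%O by apply: (fmap T (Tmk v)).
have mTT v : (m v <= (T \O T \O m) v)%O by apply: double_shift_ge.
rewrite comp_assoc (restr_natural_map (il_fwd I) Tmk TTmk) -comp_assoc -restr_restr.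
rewrite -[X in _ \c X]/(restr m (restr T (il_fwd I) \c il_bwd I)).
rewrite (restr_heq m (il_fwd_bwd I)) (restr_str G (double_shift_ge T_ge) mTT).
exact: (str_comp G mTT TTmk mTk).
Qed.

End Calculus.

(** * The interleaving of slices *)

Theorem theorem5p6 (C : RelCat) (R : realType) (N : nat)
    (U : set ('I_N -> R)) (hU : is_upset U)
    (S : {i01 R}) (c : {nonneg R}) (rho : {posnum R})
    (G : Persistent C (strip U)) (tau : Shrinking hU S c rho G)
    (e1 d : {nonneg R})
    (he : e1%:num <= Num.min (rho%:num - d%:num)
                       ((1 - S%:num) / (1 + S%:num) * d%:num))
    (e2 : {nonneg R})
    (F : Persistent C (strip U)) (I : Interleaving2 hU e1 e2 F G)
    (hI : compatible he tau I) :
  exists I' : InterleavingU hU (e2%:num + c%:num * e1%:num + c%:num * d%:num)%:nng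
                (F \O slice U d) (G \O slice U d),
    il_fwd I' =h fwd_composite he tau (il_fwd I) /\
    il_bwd I' =h bwd_composite he tau (il_bwd I).
Proof.
set E := (e2%:num + c%:num * e1%:num + c%:num * d%:num)%:nng.
set T := shiftU hU E.
pose T_ge : forall u, (u <= T u)%O := translate_ge hU E.
pose T2 := shift2 hU e1 e2.
pose i := seg_incl U rho.
pose t := shrink hU rho S c.
pose r := seg_rise hU rho c.
pose sl := slice U d.
(* [pd] and [pe] restate the local [at_d] and [at_de1], the places where [tau] is applied in [psi']
   and [phi']. *)
pose pd := seg_slice U (seg_in (small_d he)).
pose pe := seg_slice U (seg_in (small_de1 he)) \O shiftU hU e2.
have S1 := small_shrink_d he.
have S2 := small_shrink he.
have S3 := small_shrink_e1 he.
have S4 : S%:num * d%:num <= S%:num * (d%:num + e1%:num).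
  by rewrite ler_wpM2l // lerDl.
have S5 : S%:num * d%:num <= d%:num := le_trans S4 S1.
have S6 : S%:num * d%:num <= d%:num + e1%:num by rewrite ler_wpDr.
have Sde_rho : (S%:num * (d%:num + e1%:num))%:nng%:num <= rho%:num.
  exact: le_trans S1 (small_d he).
have Sd_rho : (S%:num * d%:num)%:nng%:num <= rho%:num.
  exact: le_trans S5 (small_d he).
(* [lra] treats nonlinear monomials as atoms, so bounds on products are supplied by hand. *)
have cS1 : c%:num * (S%:num * (d%:num + e1%:num)) <= c%:num * d%:num.
  exact: ler_wpM2l.
have cS5 : c%:num * (S%:num * d%:num) <= c%:num * d%:num.
  exact: ler_wpM2l.
have e20 : 0 <= e2%:num by [].
have ce0 : 0 <= c%:num * e1%:num by [].
have cd0 : 0 <= c%:num * d%:num by [].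
have bwd_fwd : restr T (bwd_composite he tau (il_bwd I)) \c
    fwd_composite he tau (il_fwd I) =h
    (str (F \O sl) (double_shift_ge T_ge) : @Mor (hoP C _) _ _).
  (* [q] is where [tau] is absorbed; [k] dominates both [t] at [d] and [r] at [q],
     while [psi] still maps it below first coordinate [d]. *)
  set q := seg_slice U (seg_in Sde_rho) \O
    shiftU hU (e2%:num + c%:num * (d%:num + e1%:num))%:nng.
  set k := slice U (S%:num * (d%:num + e1%:num))%:nng \O
    shiftU hU (E%:num + c%:num * d%:num)%:nng.
  have q_pd v : (q v <= (pd \O T) v)%O.
    by apply/andP; split => //; apply/lefP => j /=; clear -cd0; lra.
  have f_pd v : ((t \O pe) v <= (i \O (pd \O T)) v)%O.
    by apply: strip_leP => // j /=; clear; lra.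
  have f_q v : ((t \O pe) v <= (i \O q) v)%O.
    by apply: strip_leP => // j /=; clear; lra.
  have q_k v : ((r \O q) v <= k v)%O.
    by apply: strip_leP => // j /=; clear -cS1; lra.
  have pd_k v : ((t \O (pd \O T)) v <= k v)%O.
    by apply: strip_leP => // j /=; clear; lra.
  have k_sl v : ((T2 \O k) v <= (sl \O T \O T) v)%O.
    by apply: strip_leP => // j /=; clear -ce0; lra.
  have pd_sl v : ((T2 \O t \O (pd \O T)) v <= (sl \O T \O T) v)%O.
    by apply: strip_leP => // j /=; clear -ce0; lra.
  have f_sl v : ((T2 \O (t \O pe)) v <= (sl \O T \O T) v)%O.
    by apply: strip_leP => // j /=; clear -ce0 cd0; lra.
  have sl_pd v : ((sl \O T) v <= (i \O (pd \O T)) v)%O by [].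
  have sl_sl v : (sl v <= (sl \O T \O T) v)%O.
    exact: (fmap sl (double_shift_ge T_ge v)).
  set X := phi_tau he tau (il_fwd I).
  (* The last structure map of [phi'] and the initial identification in [psi'] merge into [f_pd]. *)
  transitivity ((str F pd_sl \c restr (t \O (pd \O T)) (il_bwd I) \c
      restr (pd \O T) tau \c str G f_pd) \c X :
      @Mor (hoP C _) _ (F \O sl \O T \O T)).
    rewrite /fwd_composite -/X comp_assoc.
    apply: comp_heq; last reflexivity.
    rewrite -[restr T (bwd_composite _ _ _)]/(restr T (str F (bwd_le hU c e2 he))
      \c restr T (restr (t \O pd) (il_bwd I)) \c restr T (restr pd tau)
      \c restr T (str G (slice_le he))).
    rewrite !restr_restr (restr_str F (bwd_le hU c e2 he) (k := T) pd_sl)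
      (restr_str G (slice_le he) (k := T) sl_pd) -!comp_assoc.
    do 3![apply: comp_heq; first reflexivity].
    exact: (str_comp G (fwd_le hU c e2 he) sl_pd f_pd).
  rewrite (shrink_absorb_map (sh_str tau) (il_bwd I) q_pd f_pd f_q q_k pd_k k_sl
    pd_sl f_sl).
  rewrite (@str_whisker _ _ _ _ _ _ _ F sl (functor_id _) (T \O T)
    (double_shift_ge T_ge) sl_sl).
  (* Compatibility reaches only the shift [2 e2 + c (d + e1)]; both sides factor through it, and
     [c_sl] covers the remaining [c (d + e1)]. *)
  have c_sl v : ((slice U d \O shiftU hU
      (2 * e2%:num + c%:num * (d%:num + e1%:num))%:nng) v <= (sl \O T \O T) v)%O.
    by apply: strip_leP => // j /=; clear -ce0 cd0; lra.
  rewrite -(str_comp F (compat_le hU c e2 he) c_sl) -!comp_assoc.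
  rewrite -(str_comp F (slice_compat_ge hU c d e1 e2) c_sl).
  by apply: comp_heq; [reflexivity|exact: hI].
have fwd_bwd : restr T (fwd_composite he tau (il_fwd I)) \c
    bwd_composite he tau (il_bwd I) =h
    (str (G \O sl) (double_shift_ge T_ge) : @Mor (hoP C _) _ _).
  (* [q] lifts the target of the first [tau] to the segment: [i \O q] and [t \O pd] agree
     pointwise. *)
  set q := seg_slice U (seg_in Sd_rho) \O shiftU hU (c%:num * d%:num)%:nng.
  set k := sl \O T \O T.
  have q_pe v : (q v <= (pe \O T) v)%O.
    by apply/andP; split => //; apply/lefP => j /=; clear -e20 ce0 cd0; lra.
  have f_pe v : ((t \O pd) v <= (i \O (pe \O T)) v)%O.
    by apply: strip_leP => // j /=; clear -e20 ce0 cd0; lra.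
  have f_q v : ((t \O pd) v <= (i \O q) v)%O by [].
  have q_k v : ((r \O q) v <= k v)%O.
    by apply: strip_leP => // j /=; clear -e20 ce0 cd0 cS5; lra.
  have pe_k v : ((t \O (pe \O T)) v <= k v)%O.
    by apply: strip_leP => // j /=; clear -ce0 cd0; lra.
  have f_k v : ((t \O pd) v <= k v)%O.
    by apply: strip_leP => // j /=; clear -e20 ce0 cd0; lra.
  have rd_k v : ((r \O pd) v <= k v)%O.
    by apply: strip_leP => // j /=; clear -e20 ce0 cd0; lra.
  have f_T2 v : ((t \O pd) v <= (T2 \O (sl \O T)) v)%O.
    by apply: strip_leP => // j /=; clear -e20 ce0 cd0; lra.
  have T2_pe v : ((T2 \O (sl \O T)) v <= (i \O (pe \O T)) v)%O by [].
  have sl_k v : (sl v <= k v)%O.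
    exact: (fmap sl (double_shift_ge T_ge v)).
  rewrite (@str_whisker _ _ _ _ _ _ _ G sl (functor_id _) (T \O T)
    (double_shift_ge T_ge) sl_k).
  rewrite -[restr T (fwd_composite _ _ _)]/(restr T (str G (fwd_le hU c e2 he))
    \c restr T (restr pe tau) \c restr T (str G (slice_shift2_le hU e2 he))
    \c restr T (restr sl (il_fwd I))).
  rewrite !restr_restr (restr_str G (fwd_le hU c e2 he) (k := T) pe_k)
    (restr_str G (slice_shift2_le hU e2 he) (k := T) T2_pe).
  rewrite /bwd_composite.
  pose Y : @Mor (hoP C _) (G \O sl) (G \O (t \O pd)) :=
    restr pd tau \c str G (slice_le he).
  (* Regrouping isolates [phi \c s \c psi], to which [interleaving_absorb] applies; [Y] keeps the
     [tau] of [psi']. *)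
  transitivity (str G pe_k \c restr (pe \O T) tau \c str G T2_pe \c
    (restr (sl \O T) (il_fwd I) \c str F (bwd_le hU c e2 he) \c
     restr (t \O pd) (il_bwd I)) \c Y : @Mor (hoP C _) _ (G \O sl \O T \O T)).
    by rewrite -!comp_assoc; reflexivity.
  rewrite (interleaving_absorb I (m := t \O pd) (k := sl \O T)
    (bwd_le hU c e2 he) f_T2).
  rewrite [str G T2_pe \c _]comp_assoc (str_comp G f_T2 T2_pe f_pe).
  rewrite [restr (pe \O T) tau \c _]comp_assoc comp_assoc.
  rewrite (shrink_absorb (sh_str tau) q_pe f_pe f_q q_k pe_k f_k).
  (* The remaining [tau] is absorbed in place, with [p] and [q] both equal to [pd]. *)
  exact: (shrink_absorb (sh_str tau) (fun v => lexx (pd v)) (slice_le he)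
    (slice_le he) rd_k f_k sl_k).
exists (Build_Interleaving bwd_fwd fwd_bwd).
by split; reflexivity.
Qed.
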